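(* Let $k,r$ be rational numbers with $r\neq0$, let $\varepsilon\in\{1,-1\}$, put $t=rk^4$ and $$m=\frac{k}{r}(t-5\varepsilon).$$ Then each of the following two tuples $(s_0,\dots,s_4)$ is a solution of $|F(5,m)|=1$: (1) $s_0=1,\ s_1=-\varepsilon rk^3,\ s_2=2\varepsilon rk^2,\ s_3=-2\varepsilon rk,\ s_4=\varepsilon r$; (2) $$\begin{aligned} s_0&=t^4-10\varepsilon t^3+30t^2-25\varepsilon t+1,\\ s_1&=rk^3(t^3-9\varepsilon t^2+23t-14\varepsilon),\\ s_2&=rk^2(t^3-8\varepsilon t^2+17t-7\varepsilon),\\ s_3&=rk(t^3-7\varepsilon t^2+12t-3\varepsilon),\\ s_4&=r(t^3-6\varepsilon t^2+8t-\varepsilon). \end{aligned}$$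
   Context: $|F(5,m)|$ denotes the norm of the form $s_0+s_1\sqrt[5]{m}+\dots+s_4\sqrt[5]{m^4}$, i.e. the determinant of the $5\times5$ matrix $$\begin{pmatrix} s_0&ms_4&ms_3&ms_2&ms_1\\ s_1&s_0&ms_4&ms_3&ms_2\\ s_2&s_1&s_0&ms_4&ms_3\\ s_3&s_2&s_1&s_0&ms_4\\ s_4&s_3&s_2&s_1&s_0\end{pmatrix}.$$ *)

(* Defs.v *)
From mathcomp Require Import all_boot all_order all_algebra.

Set Implicit Arguments.
Unset Strict Implicit.
Unset Printing Implicit Defensive.

Import GRing.Theory.
Local Open Scope ring_scope.

(* Column j of F5_mx m s0 s1 s2 s3 s4 holds the coordinates, in the basis
   1, w, w^2, w^3, w^4, of w^j * (s0 + s1 w + s2 w^2 + s3 w^3 + s4 w^4),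
   reduced with w^5 = m. *)
Definition F5_mx (m s0 s1 s2 s3 s4 : rat) : 'M[rat]_5 :=
  \matrix_(i < 5, j < 5)
    (nth [::]
       [:: [:: s0; m * s4; m * s3; m * s2; m * s1];
           [:: s1; s0;     m * s4; m * s3; m * s2];
           [:: s2; s1;     s0;     m * s4; m * s3];
           [:: s3; s2;     s1;     s0;     m * s4];
           [:: s4; s3;     s2;     s1;     s0    ]] i)`_j.

(* The form |F(5,m)|: a determinant, not an absolute value. *)
Definition normF5 (m s0 s1 s2 s3 s4 : rat) : rat :=
  \det (F5_mx m s0 s1 s2 s3 s4).

(* Main.v *)
Require Import Defs.
From mathcomp Require Import all_boot all_order all_algebra.
From mathcomp Require Import ring.

Import GRing.Theory.
Local Open Scope ring_scope.

(** In the ring Q[w]/(w^5 - m), the matrix [F5_mx m s0 s1 s2 s3 s4] is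
    multiplication by s0 + s1 w + ... + s4 w^4, and [normF5] is the norm of
    that element. Since

      (w - k)^5 = w^5 - k^5 - 5 k w (w - k) (w^2 - k w + k^2),

    and the hypothesis on m says precisely that m - k^5 = - 5 eps k / r,
    dividing by m - k^5 (when k is nonzero) gives

      (w - k)^5 / (m - k^5) = 1 + eps r (w^2 - k w) (w^2 - k w + k^2),

    whose coordinates are the first tuple. As w - k has norm m - k^5, the left
    side has norm (m - k^5)^5 / (m - k^5)^5 = 1. If k = 0, then m = 0 and the
    matrix is unitriangular. The second tuple is the inverse of the first
    element, hence also has norm 1. The proof carries
    this out on coordinates: [F5_mxM] is the multiplication rule,
    [normF5_subk] the norm of w - k, [first_unit_pow5] the displayed identity
    and [unit_mul_inverse] the inversion. *)

Lemma F5_mxM (m a0 a1 a2 a3 a4 b0 b1 b2 b3 b4 : rat) :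
  F5_mx m a0 a1 a2 a3 a4 *m F5_mx m b0 b1 b2 b3 b4 =
  F5_mx m
    (a0 * b0 + m * (a1 * b4 + a2 * b3 + a3 * b2 + a4 * b1))
    (a0 * b1 + a1 * b0 + m * (a2 * b4 + a3 * b3 + a4 * b2))
    (a0 * b2 + a1 * b1 + a2 * b0 + m * (a3 * b4 + a4 * b3))
    (a0 * b3 + a1 * b2 + a2 * b1 + a3 * b0 + m * (a4 * b4))
    (a0 * b4 + a1 * b3 + a2 * b2 + a3 * b1 + a4 * b0).
Proof.
apply/matrixP => i j; rewrite !mxE !big_ord_recl big_ord0 !mxE.
case: i => [[|[|[|[|[|//]]]]] ?]; case: j => [[|[|[|[|[|//]]]]] ?] /=; ring.
Qed.

Lemma F5_mxZ (m c s0 s1 s2 s3 s4 : rat) :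
  F5_mx m (c * s0) (c * s1) (c * s2) (c * s3) (c * s4) =
  c *: F5_mx m s0 s1 s2 s3 s4.
Proof.
apply/matrixP => i j; rewrite !mxE.
case: i => [[|[|[|[|[|//]]]]] ?]; case: j => [[|[|[|[|[|//]]]]] ?] /=; ring.
Qed.

Lemma F5_mx1 (m : rat) : F5_mx m 1 0 0 0 0 = 1%:M.
Proof.
apply/matrixP => i j; rewrite !mxE.
by case: i => [[|[|[|[|[|//]]]]] ?]; case: j => [[|[|[|[|[|//]]]]] ?] /=;
  rewrite ?mulr0.
Qed.

(** At m = 0 the entries above the diagonal vanish. *)
Lemma normF5_m0 (s0 s1 s2 s3 s4 : rat) : normF5 0 s0 s1 s2 s3 s4 = s0 ^+ 5.
Proof.
rewrite /normF5 det_trig.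
  by rewrite !big_ord_recl big_ord0 !mxE /=; ring.
apply/is_trig_mxP => i j; rewrite !mxE.
by case: i => [[|[|[|[|[|//]]]]] ?]; case: j => [[|[|[|[|[|//]]]]] ?] //=;
  rewrite mul0r.
Qed.

(** The first row of the matrix is (- k, 0, 0, 0, m); expanding along it leaves
    two minors, one lower triangular and one upper triangular. *)
Lemma normF5_subk (m k : rat) : normF5 m (- k) 1 0 0 0 = m - k ^+ 5.
Proof.
rewrite /normF5 (expand_det_row _ ord0) !big_ord_recl big_ord0 !mxE /=.
rewrite !mulr0 !mul0r !add0r addr0 /cofactor det_trig; last first.
  apply/is_trig_mxP => i j; rewrite !mxE.
  by case: i => [[|[|[|[|//]]]] ?]; case: j => [[|[|[|[|//]]]] ?] //=;
    rewrite mulr0.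
rewrite -[X in _ + _ * (_ * X)]det_tr det_trig; last first.
  apply/is_trig_mxP => i j; rewrite !mxE.
  by case: i => [[|[|[|[|//]]]] ?]; case: j => [[|[|[|[|//]]]] ?] //=;
    rewrite mulr0.
rewrite !big_ord_recl !big_ord0 !mxE /=; ring.
Qed.

(** The factor m - k^5 comes from replacing w^5 by m in (w - k)^5; the other
    binomial coefficients are matched through (m - k^5) eps r = - 5 k. *)
Lemma first_unit_pow5 (k r eps m : rat) (hr : r != 0) (heps : eps ^+ 2 = 1)
    (hm : m = k / r * (r * k ^+ 4 - 5 * eps)) :
  let x := F5_mx m (- k) 1 0 0 0 in
  x *m x *m (x *m x) *m x =
  (m - k ^+ 5) *: F5_mx m 1 (- eps * r * k ^+ 3) (2 * eps * r * k ^+ 2)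
    (- 2 * eps * r * k) (eps * r).
Proof.
have dE : (m - k ^+ 5) * (eps * r) = - 5 * k.
  transitivity (- 5 * k * eps ^+ 2); last by rewrite heps mulr1.
  rewrite hm; field; exact: hr.
rewrite /= !F5_mxM -F5_mxZ; congr F5_mx.
- ring.
- transitivity (- k ^+ 3 * ((m - k ^+ 5) * (eps * r))); last by ring.
  rewrite dE; ring.
- transitivity (2 * k ^+ 2 * ((m - k ^+ 5) * (eps * r))); last by ring.
  rewrite dE; ring.
- transitivity (- 2 * k * ((m - k ^+ 5) * (eps * r))); last by ring.
  rewrite dE; ring.
- rewrite dE; ring.
Qed.

Lemma normF5_first_unit (k r eps m : rat) (hr : r != 0) (heps : eps ^+ 2 = 1)
    (hm : m = k / r * (r * k ^+ 4 - 5 * eps)) :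
  normF5 m 1 (- eps * r * k ^+ 3) (2 * eps * r * k ^+ 2)
    (- 2 * eps * r * k) (eps * r) = 1.
Proof.
have [k0 | k_neq0] := eqVneq k 0.
  (* Then m = 0, and the factor m - k^5 vanishes and cannot be cancelled. *)
  by rewrite hm k0 !mul0r normF5_m0 expr1n.
have eps_neq0 : eps != 0.
  by apply/eqP => e0; move: heps; rewrite e0 expr0n => /eqP.
have d_neq0 : m - k ^+ 5 != 0.
  have -> : m - k ^+ 5 = - 5 * eps * k / r by rewrite hm; field; exact: hr.
  by rewrite !mulf_neq0 ?invr_eq0.
have := congr1 (fun A => \det A) (first_unit_pow5 _ _ _ _ hr heps hm).
rewrite detZ !det_mulmx -!/(normF5 _ _ _ _ _ _) normF5_subk.
move=> detE; apply: (mulfI (expf_neq0 5 d_neq0)).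
rewrite mulr1 -detE; ring.
Qed.

(** Exhibiting the inverse reduces its norm to that of the first unit, by
    multiplicativity of the determinant. *)
Lemma unit_mul_inverse (k r eps t m : rat) (hr : r != 0)
    (heps : eps = 1 \/ eps = -1)
    (ht : t = r * k ^+ 4) (hm : m = k / r * (t - 5 * eps)) :
  F5_mx m 1 (- eps * r * k ^+ 3) (2 * eps * r * k ^+ 2)
    (- 2 * eps * r * k) (eps * r) *m
  F5_mx m
    (t ^+ 4 - 10 * eps * t ^+ 3 + 30 * t ^+ 2 - 25 * eps * t + 1)
    (r * k ^+ 3 * (t ^+ 3 - 9 * eps * t ^+ 2 + 23 * t - 14 * eps))
    (r * k ^+ 2 * (t ^+ 3 - 8 * eps * t ^+ 2 + 17 * t - 7 * eps))
    (r * k * (t ^+ 3 - 7 * eps * t ^+ 2 + 12 * t - 3 * eps))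
    (r * (t ^+ 3 - 6 * eps * t ^+ 2 + 8 * t - eps)) = 1%:M.
Proof.
rewrite F5_mxM -(F5_mx1 m) hm ht.
by case: heps => ->; congr F5_mx; field; rewrite ?hr.
Qed.

Theorem mainTheorem5 (k r eps t m : rat)
    (hr : r != 0) (heps : eps = 1 \/ eps = -1)
    (ht : t = r * k ^+ 4) (hm : m = k / r * (t - 5 * eps)) :
  normF5 m
    1
    (- eps * r * k ^+ 3)
    (2 * eps * r * k ^+ 2)
    (- 2 * eps * r * k)
    (eps * r) = 1
  /\
  normF5 m
    (t ^+ 4 - 10 * eps * t ^+ 3 + 30 * t ^+ 2 - 25 * eps * t + 1)
    (r * k ^+ 3 * (t ^+ 3 - 9 * eps * t ^+ 2 + 23 * t - 14 * eps))
    (r * k ^+ 2 * (t ^+ 3 - 8 * eps * t ^+ 2 + 17 * t - 7 * eps))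
    (r * k * (t ^+ 3 - 7 * eps * t ^+ 2 + 12 * t - 3 * eps))
    (r * (t ^+ 3 - 6 * eps * t ^+ 2 + 8 * t - eps)) = 1.
Proof.
have eps2 : eps ^+ 2 = 1 by case: heps => ->; rewrite ?sqrrN expr1n.
have hm' : m = k / r * (r * k ^+ 4 - 5 * eps) by rewrite -ht.
have norm1 := normF5_first_unit _ _ _ _ hr eps2 hm'.
split=> //.
have := congr1 (fun A => \det A) (unit_mul_inverse _ _ _ _ _ hr heps ht hm).
by rewrite det_mulmx det1 -!/(normF5 _ _ _ _ _ _) norm1 mul1r.
Qed.
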